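(* Let $K$ be an algebraically closed field of characteristic $\ne 2$, and let $n=2^s t$ with $t$ odd and $s,t\ge1$. Every toral elementary abelian $2$-subgroup of $\mathrm{PGL}_n(K)$ whose centralizer in $\mathrm{PGL}_n(K)$ is disconnected is conjugate in $\mathrm{PGL}_n(K)$ to a subgroup of the form $D_r\times (H\otimes I_{2^r})$, where $1\le r\le s$, $n=2^rk$, and $H$ is either trivial or a toral elementary abelian $2$-subgroup of $\mathrm{PGL}_k(K)$ with $C_{\mathrm{PGL}_k(K)}(H)$ connected.
   Context: A subgroup is toral if it is contained in a maximal torus. Notation ($p=2$): for $r\ge1$, $0\le s\le r-1$, let $\sigma_s$ be the permutation of $\{1,\dots,2^r\}$ with $\sigma_s(i)=i+2^s$ if $i\equiv 1,\dots,2^s\pmod{2^{s+1}}$ and $\sigma_s(i)=i-2^s$ otherwise; $A_s$ is the $2^r\times2^r$ diagonal matrix with $(A_s)_{ii}=(-1)^{\lfloor(i-1)/2^s\rfloor}$; $B_s$ is the permutation matrix with $(B_s)_{ij}=1$ iff $\sigma_s(i)=j$. For $n=2^rk$, $\bar A_s,\bar B_s\in\mathrm{PGL}_n(K)$ are the images of $I_k\otimes A_s$, $I_k\otimes B_s$ (block diagonal, $k$ copies). $D_r=\langle\bar A_0,\dots,\bar A_{r-1}\rangle$, $B_r=\langle \bar B_0,\dots,\bar B_{r-1}\rangle$. For $H\le\mathrm{PGL}_k(K)$, $H\otimes I_{2^r}$ is the image in $\mathrm{PGL}_n(K)$ of $\{h\otimes I_{2^r}\}$ (each entry $h_{ab}$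 replaced by $h_{ab}I_{2^r}$). *)

(* Defs.v *)
From HB Require Import structures.
From mathcomp Require Import all_boot all_order all_algebra.
From mathcomp Require Import mpoly.
Set Implicit Arguments. Unset Strict Implicit. Unset Printing Implicit Defensive.
Import GRing.Theory.
Local Open Scope ring_scope.

(* Conventions: a subgroup of PGL_n(K) is represented by its full preimage in
   GL_n(K), i.e. a predicate on n x n matrices that is a subgroup of GL_n(K)
   containing all nonzero scalar matrices. *)

Section PGL.
Variable K : fieldType.

Definition proj_eq n (A B : 'M[K]_n) : Prop := exists2 a : K, a != 0 & A = a *: B.

Definition pgl_sub n (S : 'M[K]_n -> Prop) : Prop :=
  [/\ forall A, S A -> A \in unitmx,
      forall a : K, a != 0 -> S (a%:M),
      forall A B, S A -> S B -> S (A *m B)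
    & forall A, S A -> S (invmx A)].

Definition mxpoint n (A : 'M[K]_n) : 'I_(n * n) -> K := fun i => mxvec A 0 i.

(* Zariski-closed subsets of GL_n(K) (= principal open subvariety D(det) of
   the affine space M_n(K) = K^(n*n), with its subspace topology) *)
Definition gl_closed n (F : 'M[K]_n -> Prop) : Prop :=
  exists P : {mpoly K[n * n]} -> Prop,
    forall A, F A <-> (A \in unitmx /\ forall p, P p -> p.@[mxpoint A] = 0).

(* Zariski-closed subsets of PGL_n(K) = GL_n(K)/K^*  (quotient topology):
   preimages are saturated closed subsets of GL_n(K) *)
Definition pgl_closed n (F : 'M[K]_n -> Prop) : Prop :=
  gl_closed F /\ forall A (a : K), a != 0 -> F A -> F (a *: A).

Definition pgl_connected n (S : 'M[K]_n -> Prop) : Prop :=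
  ~ exists F1 F2 : 'M[K]_n -> Prop,
      [/\ pgl_closed F1 /\ pgl_closed F2,
          (forall A, S A -> F1 A \/ F2 A),
          (forall A, S A -> F1 A -> F2 A -> False),
          (exists A, S A /\ F1 A)
        & (exists A, S A /\ F2 A)].

Definition pgl_centralizer n (E : 'M[K]_n -> Prop) : 'M[K]_n -> Prop :=
  fun g => g \in unitmx /\ forall x, E x -> proj_eq (g *m x) (x *m g).

Definition elem_ab2 n (E : 'M[K]_n -> Prop) : Prop :=
  [/\ pgl_sub E,
      (forall x y, E x -> E y -> proj_eq (x *m y) (y *m x)),
      (forall x, E x -> proj_eq (x *m x) 1%:M)
    & (exists s : seq 'M[K]_n, forall x, E x -> exists2 y, y \in s & proj_eq x y)].

Definition pgl_torus n (T : 'M[K]_n -> Prop) : Prop :=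
  [/\ pgl_sub T, pgl_closed T, pgl_connected T
    & (exists2 g : 'M[K]_n, g \in unitmx &
        forall x, T x -> is_diag_mx (g *m x *m invmx g))].

Definition pgl_maxtorus n (T : 'M[K]_n -> Prop) : Prop :=
  pgl_torus T /\
  forall T', pgl_torus T' -> (forall x, T x -> T' x) -> forall x, T' x -> T x.

Definition toral n (E : 'M[K]_n -> Prop) : Prop :=
  exists2 T, pgl_maxtorus T & forall x, E x -> T x.

Definition pgl_trivial n : 'M[K]_n -> Prop :=
  fun x => exists2 a : K, a != 0 & x = a%:M.

Definition pgl_conj n (E F : 'M[K]_n -> Prop) : Prop :=
  exists2 g : 'M[K]_n, g \in unitmx & forall x, E x <-> F (g *m x *m invmx g).

Definition mx_of_fun n (f : nat -> nat -> K) : 'M[K]_n := \matrix_(i, j) f i j.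

Definition mx_at k (h : 'M[K]_k) (a b : nat) : K :=
  match insub a, insub b with
  | Some a', Some b' => h a' b'
  | _, _ => 0
  end.

(* \bar A_s in PGL_n, n = 2^r k: image of I_k (x) A_s, where A_s is the
   2^r x 2^r diagonal matrix with (A_s)_{ii} = (-1)^floor((i-1)/2^s)
   (1-based), i.e. (-1)^(i %/ 2^s) for 0-based i. *)
Definition Abar n r s : 'M[K]_n :=
  mx_of_fun n (fun i j => if i == j then (-1) ^+ ((i %% 2 ^ r) %/ 2 ^ s)%N else 0).

Definition Dr n r : 'M[K]_n -> Prop :=
  fun x => exists2 a : K, a != 0 &
    exists e : 'I_r -> nat, x = a *: \prod_(j < r) (Abar n r j) ^+ e j.

(* h (x) I_{2^r} (each entry h_ab replaced by h_ab I_{2^r}) *)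
Definition kronI n r k (h : 'M[K]_k) : 'M[K]_n :=
  mx_of_fun n (fun i j =>
    mx_at h (i %/ 2 ^ r)%N (j %/ 2 ^ r)%N * ((i %% 2 ^ r)%N == (j %% 2 ^ r)%N)%:R).

Definition tensI n r k (H : 'M[K]_k -> Prop) : 'M[K]_n -> Prop :=
  fun x => exists2 h, H h & x = kronI n r h.

Definition prod_sub n (A B : 'M[K]_n -> Prop) : 'M[K]_n -> Prop :=
  fun x => exists a b, [/\ A a, B b & x = a *m b].

End PGL.

Arguments mx_of_fun {K} n f.
Arguments Abar {K} n r s.
Arguments Dr {K} n r.
Arguments kronI {K} n r {k} h.
Arguments tensI {K} n r {k} H.

(* Main.v *)
(* Conjugating a maximal torus containing E to the diagonal one makes E diagonal.
   If every g centralizing E modulo scalars centralizes it on the nose, the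
   preimage of C(E) is the set of invertible elements of a linear space of
   matrices, which is connected. Otherwise some g anticommutes with some
   z = diag(+-1) in E. A nonzero term of the Leibniz expansion of det g gives a
   permutation of the coordinates exchanging the two eigenspaces of z and
   preserving the diagonals of all x in E that commute with g. Ordering the
   coordinates along this permutation turns z into A_0 and these x into h (x) I_2,
   so E is conjugate to D_1 x (H (x) I_2); then induct on n, applied to H. *)
Require Import Defs.
From HB Require Import structures.
From mathcomp Require Import all_boot all_order all_algebra.
From mathcomp Require Import mpoly.
From mathcomp Require Import all_fingroup mxtens boolp.
Set Implicit Arguments. Unset Strict Implicit. Unset Printing Implicit Defensive.
Import GRing.Theory.
Local Open Scope ring_scope.

(** * Zariski-closed sets restricted to a line, and connectedness of linear sections of GL_n *)

Section Lines.
Variables (K : closedFieldType) (n : nat).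
Implicit Types A B : 'M[K]_n.

Definition line_mx A B : 'M[{poly K}]_n :=
  map_mx polyC A + 'X *: map_mx polyC (B - A).

Lemma horner_line A B t : map_mx (fun p => p.[t]) (line_mx A B) = A + t *: (B - A).
Proof. by apply/matrixP=> i j; rewrite !mxE !hornerE. Qed.

Lemma horner_det_line A B t : (\det (line_mx A B)).[t] = \det (A + t *: (B - A)).
Proof.
by rewrite -horner_line -/(horner_eval t _) -det_map_mx.
Qed.

Definition mpoly_line A B (p : {mpoly K[n * n]}) : {poly K} :=
  mmap polyC (fun i => mxvec (line_mx A B) 0 i) p.

Lemma horner_mpoly_line A B p t :
  (mpoly_line A B p).[t] = p.@[mxpoint (A + t *: (B - A))].
Proof.
rewrite mevalE /mpoly_line /mmap horner_sum; apply: eq_bigr => m _.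
rewrite hornerM hornerC /mmap1 horner_prod; congr (_ * _); apply: eq_bigr => i _.
rewrite horner_exp /mxpoint -horner_line; congr (_ ^+ _).
by case/mxvec_indexP: i => i j; rewrite !mxvecE [RHS]mxE.
Qed.

(** One of the polynomials cutting out [F] does not vanish at [A]; its restriction to the line from
    [A] to [B] is [q]. *)
Lemma gl_closed_line A B (F : 'M[K]_n -> Prop) : gl_closed F -> A \in unitmx -> ~ F A ->
  exists2 q : {poly K}, q.[0] != 0 & forall t, F (A + t *: (B - A)) -> q.[t] = 0.
Proof.
case=> P FP uA nFA.
have [[p [Pp pA]]|no] := pselect (exists p, P p /\ p.@[mxpoint A] <> 0); last first.
  case: nFA; apply/FP; split=> // p Pp; apply: contrapT => np; apply: no.
  by exists p.
exists (mpoly_line A B p); first by rewrite horner_mpoly_line scale0r addr0; apply/eqP.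
by move=> t /FP [_ /(_ _ Pp)]; rewrite horner_mpoly_line.
Qed.

(* The line through two points of S meets S in a cofinite subset of the line,
   which is irreducible since K is infinite. *)
Lemma affine_pgl_connected (S L : 'M[K]_n -> Prop) :
  (forall A, S A <-> A \in unitmx /\ L A) ->
  (forall A B t, L A -> L B -> L (A + t *: (B - A))) -> pgl_connected S.
Proof.
move=> SL lin [F1 [F2 [[[c1 _] [c2 _]] cov dis [A [SA FA]] [B [SB FB]]]]].
have [[uA LA] [uB LB]] := (iffLR (SL A) SA, iffLR (SL B) SB).
have [|q2 q2A q2F] := gl_closed_line B c2 uA; first exact: dis FA.
have [|q1 q1B q1F] := gl_closed_line A c1 uB; first by move=> /dis /(_ FB); apply.
(* [q1] was obtained on the line run from [B] to [A], hence the substitution of [1 - 'X]. A non-root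
   [t] of this product gives a point of the line that is invertible, so in [S], but lies in neither
   [F1] nor [F2]. *)
have /closed_nonrootP [t] : \det (line_mx A B) * q2 * (q1 \Po (1 - 'X)) != 0.
  rewrite !mulf_neq0 //.
  - apply: contraTneq uA => d0; rewrite unitmxE unitfE.
    by have := horner_det_line A B 0; rewrite d0 horner0 scale0r addr0 => <-; rewrite eqxx.
  - by apply: contraNneq q2A => ->; rewrite horner0.
  - apply: contraNneq q1B => /(congr1 (fun p => p.[1])).
    by rewrite horner_comp !hornerE subrr => ->.
rewrite /root !hornerM !mulf_eq0 !negb_or horner_comp !hornerE => /andP [/andP [dt q2t] q1t].
set C := A + t *: (B - A).
have SC : S C.
  by apply/SL; split; [rewrite unitmxE unitfE -horner_det_line | exact: lin].
have [F1C|/q2F] := cov _ SC; last by apply/eqP.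
move/eqP: q1t; apply; apply: q1F.
suff -> : B + (1 - t) *: (A - B) = C by [].
by rewrite scalerBl scale1r addrA [B + _]addrC subrK -scalerN opprB.
Qed.

End Lines.

(** * Connected centralizers, the diagonal maximal torus, and conjugation *)

Section Tori.
Variables (K : closedFieldType) (n : nat).
Implicit Types (E : 'M[K]_n -> Prop) (g x y : 'M[K]_n).

(** Commuting exactly, not just up to a scalar, is a linear condition on [g], hence stable along
    lines. *)
Lemma centralizer_connected E :
  (forall g x, pgl_centralizer E g -> E x -> g *m x = x *m g) ->
  pgl_connected (pgl_centralizer E).
Proof.
move=> cE; apply: (affine_pgl_connected (L := fun g => forall x, E x -> g *m x = x *m g)).
  move=> g; split=> [Cg | [ug cg]]; first by split; [case: Cg | move=> x; apply: cE].
  by split=> // x Ex; exists 1; rewrite ?oner_neq0 // scale1r cg.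
move=> A B t cA cB x Ex.
rewrite mulmxDl mulmxDr -scalemxAl -scalemxAr mulmxBl mulmxBr.
by rewrite (cA _ Ex) (cB _ Ex).
Qed.

Lemma diag_ordP x : reflect (forall i j, i != j -> x i j = 0) (is_diag_mx x).
Proof. exact: is_diag_mxP. Qed.

Lemma diag_mx_entry x i j : is_diag_mx x -> i != j -> x i j = 0.
Proof. by move=> /diag_ordP dx ij; apply: dx. Qed.

Lemma diag_mxM x y i j : is_diag_mx x -> (x *m y) i j = x i i * y i j.
Proof.
move=> dx; rewrite mxE (bigD1 i) //= big1 ?addr0 // => l li.
by rewrite diag_mx_entry ?mul0r // eq_sym.
Qed.

Lemma mx_diagM x y i j : is_diag_mx y -> (x *m y) i j = x i j * y j j.
Proof.
move=> dy; rewrite mxE (bigD1 j) //= big1 ?addr0 // => l lj.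
by rewrite (diag_mx_entry dy lj) mulr0.
Qed.

Lemma is_diag_mxM x y : is_diag_mx x -> is_diag_mx y -> is_diag_mx (x *m y).
Proof.
move=> dx dy; apply/diag_ordP=> i j ij.
by rewrite diag_mxM // (diag_mx_entry dy) ?mulr0.
Qed.

Lemma diag_mx_comm x y : is_diag_mx x -> is_diag_mx y -> x *m y = y *m x.
Proof.
move=> dx dy; apply/matrixP=> i j; rewrite diag_mxM // mx_diagM //.
have [->|ij] := eqVneq i j; first exact: mulrC.
by rewrite (diag_mx_entry dy) // mulr0 mul0r.
Qed.

Lemma is_diag_invmx x : is_diag_mx x -> is_diag_mx (invmx x).
Proof.
move=> dx; have [ux|] := boolP (x \in unitmx); last by move=> nux; rewrite invmx_out.
have xi i : x i i != 0.
  apply: contraTneq ux => xi0; rewrite unitmxE unitfE; apply/negPn/det0P.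
  exists (delta_mx 0 i); first by apply/eqP => /rowP/(_ i)/eqP; rewrite !mxE !eqxx oner_eq0.
  apply/rowP=> j; rewrite -rowE !mxE; have [<-//|ij] := eqVneq i j.
  exact: diag_mx_entry.
apply/diag_ordP=> i j ij; apply: (mulfI (xi i)).
by rewrite mulr0 -diag_mxM // mulmxV // mxE (negbTE ij).
Qed.

Definition diag_torus : 'M[K]_n -> Prop := fun x => x \in unitmx /\ is_diag_mx x.

Lemma diag_torus_maxtorus (hK : (2%:R : K) != 0) : pgl_maxtorus diag_torus.
Proof.
split; first split.
- split.
  + by move=> A [].
  + move=> a a0; split; last exact: scalar_mx_is_diag.
    by rewrite unitmxE det_scalar unitfE expf_eq0 (negbTE a0) andbF.
  + by move=> A B [uA dA] [uB dB]; split; [rewrite unitmx_mul uA | exact: is_diag_mxM].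
  + by move=> A [uA dA]; split; [rewrite unitmx_inv | exact: is_diag_invmx].
- split.
    exists (fun p => exists i j : 'I_n, i != j /\ p = 'X_(mxvec_index i j)) => A.
    split=> [[uA dA] | [uA eA]]; split=> //.
      by move=> p [i [j [ij ->]]]; rewrite mevalXU /mxpoint mxvecE diag_mx_entry.
    apply/diag_ordP => i j ij; rewrite -mxvecE -/(mxpoint A _) -mevalXU.
    by apply: eA; exists i, j.
  move=> A a a0 [uA dA]; split; first by rewrite unitmxZ ?unitfE.
  by apply/diag_ordP => i j ij; rewrite mxE diag_mx_entry ?mulr0.
- apply: (affine_pgl_connected (L := fun x => is_diag_mx x)) => // A B t dA dB.
  by apply/diag_ordP => i j ij /=; rewrite !mxE !diag_mx_entry // oppr0 addr0 mulr0 addr0.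
- by exists 1%:M; rewrite ?unitmx1 // => x [_ dx]; rewrite invmx1 mul1mx mulmx1.
move=> T' [[uT _ _ _] _ _ [g ug dg]] sT x Tx; split; first exact: uT.
apply/diag_ordP => i j ij.
(* The sign matrix [d] separates coordinate [i] from all others. The larger torus [T'] is
   diagonalizable, hence commutative, so [x] commutes with [d]; at entry [(i, j)] this reads
   [- x i j = x i j], and 2 is invertible. *)
pose d : 'M[K]_n := diag_mx (\row_l (if l == i then 1 else -1)).
have Td : T' d.
  apply: sT; split; last exact: diag_mx_is_diag.
  rewrite unitmxE det_diag unitfE; apply/prodf_neq0 => l _; rewrite mxE.
  by case: ifP; rewrite ?oppr_eq0 oner_eq0.
have cxd : x *m d = d *m x.
  have := diag_mx_comm (dg _ Tx) (dg _ Td); rewrite !mulmxA !mulmxKV //.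
  by move/(can_inj (mulmxK (etrans (unitmx_inv g) ug))); rewrite -!mulmxA; move/(can_inj (mulKmx ug)).
have := congr1 (fun y : 'M_n => y i j) cxd.
rewrite mx_diagM ?diag_mx_is_diag // diag_mxM ?diag_mx_is_diag // !mxE !eqxx eq_sym (negbTE ij) !mulr1n mul1r.
move/eqP; rewrite mulrN1 eq_sym -addr_eq0 -mulr2n -mulr_natr mulf_eq0 (negbTE hK) orbF.
by move/eqP.
Qed.

Lemma diag_toral (hK : (2%:R : K) != 0) E :
  (forall x, E x -> x \in unitmx /\ is_diag_mx x) -> toral E.
Proof. by move=> dE; exists diag_torus => //; exact: diag_torus_maxtorus. Qed.

Definition mxconj g x := g *m x *m invmx g.

Lemma mxconjM g x y : g \in unitmx -> mxconj g (x *m y) = mxconj g x *m mxconj g y.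
Proof. by move=> ug; rewrite /mxconj !mulmxA mulmxKV. Qed.

Lemma mxconj_mul g h x : g \in unitmx -> h \in unitmx ->
  mxconj (g *m h) x = mxconj g (mxconj h x).
Proof.
move=> ug uh; have ugh : g *m h \in unitmx by rewrite unitmx_mul ug.
suff -> : mxconj (g *m h) x = g *m h *m x *m (invmx h *m invmx g).
  by rewrite /mxconj !mulmxA.
congr (_ *m _); apply: (can_inj (mulKmx ugh)).
by rewrite mulmxV // mulmxA mulmxK // mulmxV.
Qed.

Lemma mxconjZ g a x : mxconj g (a *: x) = a *: mxconj g x.
Proof. by rewrite /mxconj -scalemxAr -scalemxAl. Qed.

Lemma mxconj1 g a : g \in unitmx -> mxconj g a%:M = a%:M.
Proof. by move=> ug; rewrite /mxconj scalar_mxC mulmxK. Qed.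

Lemma mxconjK g : g \in unitmx -> cancel (mxconj g) (mxconj (invmx g)).
Proof. by move=> ug x; rewrite -mxconj_mul ?unitmx_inv // mulVmx // /mxconj invmx1 mul1mx mulmx1. Qed.

Lemma mxconjVK g : g \in unitmx -> cancel (mxconj (invmx g)) (mxconj g).
Proof. by move=> ug x; rewrite -mxconj_mul ?unitmx_inv // mulmxV // /mxconj invmx1 mul1mx mulmx1. Qed.

Lemma unitmx_conj g x : g \in unitmx -> (mxconj g x \in unitmx) = (x \in unitmx).
Proof. by move=> ug; rewrite !unitmx_mul unitmx_inv ug andbT. Qed.

Lemma mxconj_inv g x : g \in unitmx -> x \in unitmx -> mxconj g (invmx x) = invmx (mxconj g x).
Proof.
move=> ug ux; have uc : mxconj g x \in unitmx by rewrite unitmx_conj.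
apply: (can_inj (mulKmx uc)).
by rewrite mulmxV // -mxconjM // mulmxV // mxconj1.
Qed.

Lemma proj_eq_conj g x y : proj_eq x y -> proj_eq (mxconj g x) (mxconj g y).
Proof. by case=> a a0 ->; exists a; rewrite ?mxconjZ. Qed.

Lemma elem_ab2_conj g E : g \in unitmx -> elem_ab2 E ->
  elem_ab2 (fun x => E (mxconj g x)).
Proof.
move=> ug [[uE sE mE iE] cE qE [s fE]]; split; first split.
- by move=> A /uE; rewrite unitmx_conj.
- by move=> a a0; rewrite mxconj1 //; apply: sE.
- by move=> A B EA EB; rewrite mxconjM //; apply: mE.
- move=> A EA; rewrite mxconj_inv //; first exact: iE.
  by rewrite -(unitmx_conj _ ug) uE.
- move=> x y Ex Ey; rewrite -[x *m y](mxconjK ug) -[y *m x](mxconjK ug) !(mxconjM _ _ ug).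
  by apply/proj_eq_conj/cE.
- move=> x Ex; rewrite -[x *m x](mxconjK ug) (mxconjM _ _ ug) -[1%:M](mxconj1 (g := invmx g)) ?unitmx_inv //.
  by apply/proj_eq_conj/qE.
exists (map (mxconj (invmx g)) s) => x /fE [y ys xy].
exists (mxconj (invmx g) y); first exact: map_f.
by rewrite -[x](mxconjK ug); apply: proj_eq_conj.
Qed.

Lemma pgl_conj_trans E F G : pgl_conj E F -> pgl_conj F G -> pgl_conj E G.
Proof.
move=> [g ug gE] [h uh hF]; exists (h *m g) => [|x]; first by rewrite unitmx_mul uh.
by rewrite -[_ *m invmx _]/(mxconj _ _) mxconj_mul // gE hF.
Qed.

End Tori.

(** * The embedding of h as h (x) I_{2^r} *)

Section Kron.
Variable K : closedFieldType.

Lemma mx_at_ord k (h : 'M[K]_k) (a b : 'I_k) : mx_at h a b = h a b.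
Proof. by rewrite /mx_at !valK. Qed.

(** Writing an index as [a * 2 ^ r + b] with [b < 2 ^ r] identifies [kronI] with the Kronecker
    product, from which multiplicativity is inherited. The order [k * 2 ^ r] of the factors is the
    one in the type of [*t]. *)
Lemma kronIE r k (h : 'M[K]_k) :
  kronI (k * 2 ^ r) r h = h *t (1%:M : 'M_(2 ^ r)).
Proof.
apply/matrixP=> i j; case: (mxtens_indexP i) => a b; case: (mxtens_indexP j) => c d.
rewrite tensmxE [LHS]mxE !mxE /= !divnMDl ?expn_gt0 // !divn_small // !addn0.
by rewrite mx_at_ord !modnMDl !modn_small.
Qed.

Lemma kronIM n r k (g h : 'M[K]_k) : n = (2 ^ r * k)%N ->
  kronI n r (g *m h) = kronI n r g *m kronI n r h.
Proof. by rewrite mulnC => ->; rewrite !kronIE tensmx_mul mulmx1. Qed.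

Lemma kronI1 n r k : n = (2 ^ r * k)%N -> kronI n r (1%:M : 'M[K]_k) = 1%:M.
Proof.
rewrite mulnC => ->; rewrite kronIE; apply/matrixP=> i j.
case: (mxtens_indexP i) => a b; case: (mxtens_indexP j) => c d.
by rewrite tensmxE !mxE -natrM mulnb (can_eq (@mxtens_indexK _ _)).
Qed.

Lemma kronIZ n r k a (h : 'M[K]_k) : n = (2 ^ r * k)%N ->
  kronI n r (a *: h) = a *: kronI n r h.
Proof. by rewrite mulnC => ->; rewrite !kronIE; apply/matrixP=> i j; rewrite !mxE mulrA. Qed.

Lemma kronI_unit n r k (h : 'M[K]_k) : n = (2 ^ r * k)%N ->
  h \in unitmx -> kronI n r h \in unitmx.
Proof.
move=> hn uh; suff /mulmx1_unit [] : kronI n r h *m kronI n r (invmx h) = 1%:M by [].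
by rewrite -kronIM // mulmxV // kronI1.
Qed.

Lemma kronI_inv n r k (h : 'M[K]_k) : n = (2 ^ r * k)%N ->
  h \in unitmx -> kronI n r (invmx h) = invmx (kronI n r h).
Proof.
move=> hn uh; have uk := kronI_unit hn uh.
by apply: (can_inj (mulKmx uk)); rewrite -kronIM // !mulmxV // kronI1.
Qed.

Lemma kronI_conj n r k (g h : 'M[K]_k) : n = (2 ^ r * k)%N -> g \in unitmx ->
  kronI n r (mxconj g h) = mxconj (kronI n r g) (kronI n r h).
Proof. by move=> hn ug; rewrite /mxconj -kronI_inv // !kronIM. Qed.

Lemma kronI_prod n r k m (h : 'I_m -> 'M[K]_k) (e : 'I_m -> nat) : n = (2 ^ r * k)%N ->
  kronI n r (\prod_(j < m) h j ^+ e j) = \prod_(j < m) kronI n r (h j) ^+ e j.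
Proof.
move=> hn; have kM : {morph @kronI K n r k : x y / x * y} by move=> x y; apply: kronIM.
rewrite (big_morph _ kM (kronI1 hn)); apply: eq_bigr => j _.
by elim: (e j) => [|i IH]; [exact: kronI1 | rewrite !exprS kM IH].
Qed.

Lemma divn2_lt n k (i : 'I_n) : n = (2 ^ 1 * k)%N -> (i %/ 2 ^ 1 < k)%N.
Proof. by move=> hn; rewrite ltn_divLR // mulnC -hn. Qed.

(** Two indices agree modulo [2 ^ r.+1] exactly when they agree modulo 2 and their halves agree
    modulo [2 ^ r]. *)
Lemma kronI_kronI n k r m (h : 'M[K]_m) : n = (2 ^ 1 * k)%N ->
  kronI n 1 (kronI k r h) = kronI n r.+1 h.
Proof.
move=> hn; apply/matrixP=> i j; rewrite !mxE.
rewrite -[(i %/ _)%N]/(nat_of_ord (Ordinal (divn2_lt i hn))).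
rewrite -[(j %/ _)%N]/(nat_of_ord (Ordinal (divn2_lt j hn))) mx_at_ord mxE /=.
rewrite -!divnMA -!expnD !add1n -mulrA -natrM mulnb; congr (_ * _%:R).
rewrite expn1 !modn_divl -expnSr.
rewrite -[(i %% 2)%N](@modn_dvdm (2 ^ r.+1)) ?dvdn_exp // -[(j %% 2)%N](@modn_dvdm (2 ^ r.+1)) ?dvdn_exp //.
congr nat_of_bool; apply/andP/eqP => [[/eqP e1 /eqP e2]|-> //].
by rewrite [LHS](divn_eq _ 2) e1 e2 -divn_eq.
Qed.

End Kron.

(** * Tensoring with I_2 turns D_r into the part of D_{r+1} generated by A_1, ..., A_r *)

Section Composition.
Variable K : closedFieldType.

(** The sign in A_j is given by a binary digit of the index, and halving the index shifts digit
    [j.+1] to digit [j]. *)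
Lemma kronI_Abar n k r j : n = (2 ^ 1 * k)%N ->
  kronI n 1 (Abar k r j : 'M[K]_k) = Abar n r.+1 j.+1.
Proof.
move=> hn; apply/matrixP=> a b; rewrite !mxE.
rewrite -[(a %/ _)%N]/(nat_of_ord (Ordinal (divn2_lt a hn))).
rewrite -[(b %/ _)%N]/(nat_of_ord (Ordinal (divn2_lt b hn))) mx_at_ord mxE /= expn1.
rewrite modn_divl -expnSr -divnMA -expnS.
have -> : (a == b :> nat) = (a %/ 2 == b %/ 2)%N && (a %% 2 == b %% 2)%N.
  apply/eqP/andP => [-> // | [/eqP e1 /eqP e2]].
  by rewrite [LHS](divn_eq _ 2) e1 e2 -divn_eq.
by case: eqP => _; case: eqP => _; rewrite ?mulr1 ?mulr0.
Qed.

(** Reduction modulo [2 ^ r.+1] preserves parity, so A_0 is the same matrix for every block size. *)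
Lemma Abar_sign n r i j :
  (Abar n r.+1 0 : 'M[K]_n) i j = (-1) ^+ odd i *+ (i == j).
Proof.
rewrite mxE expn0 divn1 -signr_odd odd_mod ?oddX //.
by rewrite -val_eqE; case: eqP.
Qed.

Lemma Abar_diag n r : is_diag_mx (Abar n r.+1 0 : 'M[K]_n).
Proof. by apply/diag_ordP => i j ij; rewrite Abar_sign (negbTE ij). Qed.

Lemma Abar0 n r : Abar n r.+1 0 = Abar n 1 0 :> 'M[K]_n.
Proof. by apply/matrixP => i j; rewrite !Abar_sign. Qed.

(** A_0 is scalar on each parity class of indices, and [kronI n 1 g] has nonzero entries only
    between indices of equal parity. *)
Lemma Abar_kronI_comm n k (g : 'M[K]_k) :
  Abar n 1 0 *m kronI n 1 g = kronI n 1 g *m Abar n 1 0.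
Proof.
apply/matrixP => i j; rewrite diag_mxM ?Abar_diag // mx_diagM ?Abar_diag //.
rewrite !Abar_sign !eqxx [kronI _ _ _ _ _]mxE expn1 !modn2 mulrC.
by have [->//|ij] := eqVneq (odd i) (odd j); case: (odd i) (odd j) ij => [] []; rewrite ?mulr0 ?mul0r.
Qed.

Lemma Dr1P n (x : 'M[K]_n) :
  Dr n 1 x <-> exists a e, a != 0 /\ x = a *: (Abar n 1 0) ^+ e.
Proof.
split=> [[a a0 [e ->]] | [a [e [a0 ->]]]].
  by exists a, (e ord0); rewrite big_ord1.
by exists a => //; exists (fun => e); rewrite big_ord1.
Qed.

(** This is the inductive step. A conjugator [g] for [H1] lifts to g (x) I_2, which fixes A_0; the
    generators of D_r become A_1, ..., A_r and complete A_0 to D_{r+1}. *)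
Lemma conj_prod_sub n k r m (H1 : 'M[K]_k -> Prop) (H : 'M[K]_m -> Prop) :
  n = (2 ^ 1 * k)%N -> pgl_conj H1 (prod_sub (Dr k r) (tensI k r H)) ->
  pgl_conj (prod_sub (Dr n 1) (tensI n 1 H1)) (prod_sub (Dr n r.+1) (tensI n r.+1 H)).
Proof.
move=> hn [g ug gH].
have uG := kronI_unit hn ug; exists (kronI n 1 g) => // x.
rewrite -[_ *m invmx _]/(mxconj _ _).
have cA e : mxconj (kronI n 1 g) ((Abar n 1 0 : 'M_n) ^+ e) = (Abar n 1 0 : 'M_n) ^+ e.
  suff cc : kronI n 1 g *m (Abar n 1 0 : 'M_n) ^+ e = (Abar n 1 0 : 'M_n) ^+ e *m kronI n 1 g.
    by rewrite /mxconj cc mulmxK.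
  by apply: (@commrX 'M[K]_n); rewrite /GRing.comm -[LHS]Abar_kronI_comm.
split=> [[_ [_ [/Dr1P [a [e [a0 ->]]] [h H1h ->] ->]]] | [_ [_ [[a a0 [e ->]] [h Hh ->] xE]]]].
  have /gH [_ [_ [[b b0 [f ->]] [h' Hh' ->] hE]]] := H1h.
  rewrite mxconjM // mxconjZ cA -kronI_conj // /mxconj hE.
  (* The exponent of A_0 is [e], and that of A_{i+1} is the exponent [f i] of A_i in D_r. *)
  exists ((a * b) *: \prod_(j < r.+1) Abar n r.+1 j ^+ (if unlift ord0 j is Some i then f i else e)), (kronI n r.+1 h').
  split; [|by exists h'|].
    exists (a * b); first exact: mulf_neq0.
    by exists (fun j => if unlift ord0 j is Some i then f i else e).
  rewrite kronIM // kronI_kronI // kronIZ // kronI_prod // big_ord_recl unlift_none Abar0.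
  rewrite mulmxA -scalemxAl -!scalemxAr scalerA; congr (_ *: (_ *m _) *m _).
  by apply: eq_bigr => j _; rewrite liftK kronI_Abar.
(* [y] gathers all of [x] except the power of A_0, read one level down in size [k]. *)
pose y := a *: \prod_(j < r) Abar k r j ^+ e (lift ord0 j) *m kronI k r h.
exists (Abar n 1 0 ^+ e ord0), (kronI n 1 (mxconj (invmx g) y)).
split.
- by apply/Dr1P; exists 1, (e ord0); rewrite scale1r oner_neq0.
- exists (mxconj (invmx g) y) => //; apply/gH; rewrite -[_ *m invmx _]/(mxconj _ _) mxconjVK //.
  exists (a *: \prod_(j < r) Abar k r j ^+ e (lift ord0 j)), (kronI k r h); split=> //.
    by exists a => //; exists (fun j => e (lift ord0 j)).
  by exists h.
apply: (can_inj (mxconjK uG)); rewrite xE mxconjM // cA -kronI_conj // mxconjVK //.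
rewrite /y kronIM // kronI_kronI // kronIZ // kronI_prod // big_ord_recl Abar0 mulmxA.
rewrite -!scalemxAr; congr (_ *: (_ *m _) *m _).
by apply: eq_bigr => j _; rewrite kronI_Abar.
Qed.

End Composition.

(** * Splitting off one factor D_1, and the induction *)

Section Splitting.
Variable K : closedFieldType.

(** The elements of [E] commuting exactly with [g] are those that will give the factor [H]. *)
Lemma elem_ab2_commutant n (E : 'M[K]_n -> Prop) g : elem_ab2 E ->
  elem_ab2 (fun x => E x /\ g *m x = x *m g).
Proof.
case=> [[uE sE mE iE] cE qE [s fE]]; split; first split.
- by move=> A [/uE].
- by move=> a a0; split; [exact: sE | rewrite scalar_mxC].
- by move=> A B [EA cA] [EB cB]; split; [exact: mE | rewrite mulmxA cA -mulmxA cB mulmxA].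
- move=> A [EA cA]; split; first exact: iE.
  have uA := uE _ EA; apply: (can_inj (mulKmx uA)); apply: (can_inj (mulmxK uA)).
  by rewrite mulmxA -cA mulmxK // mulmxA mulmxV // mul1mx.
- by move=> x y [Ex _] [Ey _]; apply: cE.
- by move=> x [Ex _]; apply: qE.
by exists s => x [Ex _]; apply: fE.
Qed.

Section DiagonalMinors.
Variables (n k : nat) (p : 'I_k -> 'I_n).
Hypothesis p_inj : injective p.
Implicit Types x y : 'M[K]_n.

Lemma mxsub_diag x : is_diag_mx x -> is_diag_mx (mxsub p p x).
Proof.
move=> dx; apply/diag_ordP => a b ab.
by rewrite mxE diag_mx_entry // (inj_eq p_inj).
Qed.

(** Row [p a] of a diagonal [x] has its only possible nonzero entry inside the chosen coordinates,
    so no term of the product is lost by restriction. *)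
Lemma mxsub_diagM x y : is_diag_mx x ->
  mxsub p p (x *m y) = mxsub p p x *m mxsub p p y.
Proof.
move=> dx; apply/matrixP => a b; rewrite mxE diag_mxM // diag_mxM ?mxsub_diag //.
by rewrite !mxE.
Qed.

Lemma mxsub_scalar (a : K) : mxsub p p (a%:M : 'M_n) = a%:M.
Proof. by apply/matrixP => i j; rewrite !mxE (inj_eq p_inj). Qed.

Lemma mxsub_diagV x : x \in unitmx -> is_diag_mx x ->
  mxsub p p x \in unitmx /\ mxsub p p (invmx x) = invmx (mxsub p p x).
Proof.
move=> ux dx; have e : mxsub p p x *m mxsub p p (invmx x) = 1%:M.
  by rewrite -mxsub_diagM // mulmxV // mxsub_scalar.
have [u1 _] := mulmx1_unit e; split=> //.
by apply: (can_inj (mulKmx u1)); rewrite e mulmxV.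
Qed.

Lemma proj_eq_mxsub x y : proj_eq x y -> proj_eq (mxsub p p x) (mxsub p p y).
Proof. by case=> a a0 ->; exists a => //; apply/matrixP => i j; rewrite !mxE. Qed.

Lemma elem_ab2_mxsub (E : 'M[K]_n -> Prop) : elem_ab2 E ->
  (forall x, E x -> is_diag_mx x) ->
  elem_ab2 (fun h => exists2 x, E x & h = mxsub p p x).
Proof.
case=> [[uE sE mE iE] cE qE [s fE]] dE; split; first split.
- by move=> _ [x Ex ->]; case: (mxsub_diagV (uE _ Ex) (dE _ Ex)).
- by move=> a a0; exists a%:M; rewrite ?mxsub_scalar //; apply: sE.
- by move=> _ _ [x Ex ->] [y Ey ->]; exists (x *m y); [exact: mE | rewrite mxsub_diagM ?dE].
- move=> _ [x Ex ->]; exists (invmx x); first exact: iE.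
  by case: (mxsub_diagV (uE _ Ex) (dE _ Ex)).
- move=> _ _ [x Ex ->] [y Ey ->]; rewrite -!mxsub_diagM ?dE //.
  exact/proj_eq_mxsub/cE.
- move=> _ [x Ex ->]; rewrite -mxsub_diagM ?dE // -(mxsub_scalar 1).
  exact/proj_eq_mxsub/qE.
exists (map (mxsub p p) s) => _ [x /fE [y ys xy] ->].
by exists (mxsub p p y); [exact: map_f | exact: proj_eq_mxsub].
Qed.

End DiagonalMinors.

Lemma unitmx_transversal n (g : 'M[K]_n) : g \in unitmx ->
  exists s : {perm 'I_n}, forall i, g i (s i) != 0.
Proof.
move=> ug; apply: contrapT => no; move: ug; rewrite unitmxE unitfE /determinant.
rewrite big1 ?eqxx // => s _; apply/eqP; rewrite mulf_eq0 signr_eq0 /=.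
apply/prodf_eq0; apply: contrapT => nz; apply: no; exists s => i.
by apply/eqP => gi0; apply: nz; exists i => //; apply/eqP.
Qed.

Lemma mxconj_perm n (s : {perm 'I_n}) (x : 'M[K]_n) i j :
  mxconj (perm_mx s) x i j = x (s i) (s j).
Proof.
have us := unitmx_perm K s.
have -> : mxconj (perm_mx s) x = perm_mx s *m x *m perm_mx s^-1.
  congr (_ *m _); apply: (can_inj (mulKmx us)).
  by rewrite mulmxV // -perm_mxM mulgV perm_mx1.
by rewrite -col_permE -row_permE !mxE.
Qed.

(** Here [H] is the restriction, to the +1 eigenspace of the involution [z], of the elements of [E]
    commuting with [g]. *)
Lemma diag_split (hK : (2%:R : K) != 0) n (E : 'M[K]_n -> Prop) g x0 :
  (0 < n)%N -> elem_ab2 E -> (forall x, E x -> is_diag_mx x) ->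
  pgl_centralizer E g -> E x0 -> g *m x0 != x0 *m g ->
  exists k (H : 'M[K]_k -> Prop), [/\ n = (2 ^ 1 * k)%N, elem_ab2 H, toral H
    & pgl_conj E (prod_sub (Dr n 1) (tensI n 1 H))].
Proof.
move=> n0 abE dE [ug cg] Ex0 ncx0; have [[uE sE mE iE] cE qE _] := abE.
have [s gs] := unitmx_transversal ug.
(* Compare entries [(i, s i)] on both sides and cancel [g i (s i)], which is nonzero by the choice
   of [s]. *)
have eig x a i : E x -> g *m x = a *: (x *m g) -> x (s i) (s i) = a * x i i.
  move=> Ex /(congr1 (fun y : 'M_n => y i (s i))).
  rewrite mx_diagM ?dE // mxE diag_mxM ?dE // mulrA mulrC => /mulIf; apply.
  exact: gs.
have sqE x : E x -> exists2 c, c != 0 & forall i, x i i * x i i = c.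
  move=> Ex; have [c c0 xx] := qE _ Ex; exists c => // i.
  by rewrite -diag_mxM ?dE // xx !mxE eqxx mulr1.
(* The entries of [x] at [i] and [s i] differ by the factor [a] but have the same square [c], so [a]
   is 1 or -1. *)
have dich x : E x -> g *m x = x *m g \/ g *m x = - (x *m g).
  move=> Ex; have [a a0 gx] := cg _ Ex; have [c c0 xc] := sqE _ Ex.
  have /eqP : a * a = 1.
    apply: (mulIf c0); rewrite mul1r -[in RHS](xc (s (Ordinal n0))) -(xc (Ordinal n0)).
    by rewrite (eig _ _ _ Ex gx) mulrACA.
  rewrite -expr2 -subr_eq0 subr_sqr_1 mulf_eq0 subr_eq0 addr_eq0 gx.
  by case/orP => /eqP ->; [left; rewrite scale1r | right; rewrite scaleN1r].
(* Dividing [x0] by one of its diagonal entries makes all diagonal entries 1 or -1, because they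
   share the same square. *)
pose w := x0 (Ordinal n0) (Ordinal n0).
have [c c0 xc] := sqE _ Ex0.
have w0 : w != 0 by apply: contraNneq c0 => w0; rewrite -(xc (Ordinal n0)) -/w w0 mul0r.
pose z : 'M[K]_n := w^-1 *: x0.
have Ez : E z by rewrite /z -mul_scalar_mx; apply: mE => //; apply: sE; rewrite invr_eq0.
have gz : g *m z = - (z *m g).
  rewrite /z -scalemxAr -scalemxAl -scalerN; case: (dich _ Ex0) => [e|-> //].
  by rewrite e eqxx in ncx0.
have zs i : z (s i) (s i) = - z i i.
  by rewrite (@eig z (-1) i Ez) ?mulN1r // scaleN1r.
have z1 i : z i i = 1 \/ z i i = -1.
  have /eqP : z i i ^+ 2 = 1.
    by rewrite mxE exprMn exprVn !expr2 (xc i) (xc (Ordinal n0)) mulVf.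
  by rewrite -subr_eq0 subr_sqr_1 mulf_eq0 subr_eq0 addr_eq0 => /orP [] /eqP; [left|right].
have N11 : (-1 : K) != 1 by rewrite eq_sym -addr_eq0.
pose P := [set i | z i i == 1]; pose k := #|P|.
(* [s] negates the entries of [z], so it exchanges the two eigenspaces, and each has dimension
   [n / 2]. *)
have sP : s @^-1: P = ~: P.
  apply/setP => i; rewrite !inE zs; case: (z1 i) => ->; rewrite ?opprK ?eqxx ?(negbTE N11) //.
have hn : n = (2 ^ 1 * k)%N.
  rewrite expn1 mul2n -addnn {1}/k -(on_card_preimset (f := s)); last first.
    exact/onW_bij/(Bijective (permK s) (permKV s)).
  by rewrite sP addnC /k cardsC card_ord.
pose p : 'I_k -> 'I_n := enum_val.
have zp a : z (p a) (p a) = 1 by have := enum_valP a; rewrite inE => /eqP.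
have p_inj : injective p := enum_val_inj.
pose h (i : 'I_n) : 'I_k := Ordinal (divn2_lt i hn).
(* Position [2a] receives the coordinate [p a], and position [2a + 1] its image under [s].
   Injectivity follows since [z] at [f i] recovers the parity of [i]. *)
pose f (i : 'I_n) := if odd i then s (p (h i)) else p (h i).
have zf i : z (f i) (f i) = (-1) ^+ odd i.
  by rewrite /f; case: odd; rewrite ?zs zp.
have f_inj : injective f.
  move=> i j fij.
  have oij : odd i = odd j.
    have := zf i; rewrite fij zf; case: (odd i) (odd j) => [] [] // /eqP.
      by rewrite expr0 expr1 eq_sym (negbTE N11).
    by rewrite expr0 expr1 (negbTE N11).
  have : p (h i) = p (h j) by move: fij; rewrite /f oij; case: odd => // /perm_inj.
  move/p_inj/(congr1 val) => /= hij; apply: val_inj => /=.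
  by rewrite (divn_eq i 2) (divn_eq j 2) !modn2 oij hij.
pose G : 'M[K]_n := perm_mx (perm f_inj).
have uG : G \in unitmx by exact: unitmx_perm.
have Gz : mxconj G z = Abar n 1 0.
  apply/matrixP => i j; rewrite mxconj_perm !permE Abar_sign.
  by have [->|ij] := eqVneq i j; rewrite ?zf // diag_mx_entry ?dE // (inj_eq f_inj).
pose C x := E x /\ g *m x = x *m g.
(* With factor 1 in [eig], such an [x] has equal entries at [p a] and [s (p a)], that is, at each
   pair of positions [2a], [2a + 1]. *)
have GC x : C x -> mxconj G x = kronI n 1 (mxsub p p x).
  case=> Ex cx; have xs i : x (s i) (s i) = x i i.
    by rewrite (@eig x 1 i Ex) ?mul1r // scale1r.
  apply/matrixP => i j; rewrite mxconj_perm !permE mxE.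
  rewrite -[(i %/ _)%N]/(nat_of_ord (h i)) -[(j %/ _)%N]/(nat_of_ord (h j)) mx_at_ord mxE.
  have [->|ij] := eqVneq i j.
    by rewrite eqxx mulr1 /f; case: odd => //.
  rewrite diag_mx_entry ?dE // ?(inj_eq f_inj) //.
  have [hij|hij] := eqVneq (h i) (h j); last first.
    by rewrite diag_mx_entry ?dE ?(inj_eq p_inj) // mul0r.
  have [mij|] := eqVneq (i %% 2 ^ 1)%N; last by rewrite mulr0.
  by case/eqP: ij; apply: val_inj; rewrite /= (divn_eq i 2) mij [(i %/ 2)%N](congr1 val hij) -divn_eq.
exists k, (fun h => exists2 x, C x & h = mxsub p p x).
have dC x : C x -> is_diag_mx x by case=> /dE.
have abH := elem_ab2_mxsub p_inj (elem_ab2_commutant g abE) dC.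
split=> //.
  apply: diag_toral => // x Hx; split; first by case: abH => [[uH _ _ _] _ _ _]; apply: uH.
  by case: Hx => y Cy ->; apply/mxsub_diag/dC.
have zz : z *m z = 1%:M.
  apply/matrixP => i j; rewrite diag_mxM ?dE // [RHS]mxE.
  have [->|ij] := eqVneq i j; last by rewrite (diag_mx_entry (dE _ Ez) ij) mulr0.
  by case: (z1 j) => ->; rewrite ?mulrNN mulr1.
exists G => // x; rewrite -[_ *m invmx _]/(mxconj _ _); split=> [Ex|].
  have [cx|ncx] := dich _ Ex.
    exists 1%:M, (mxconj G x); split; last by rewrite mul1mx.
      by apply/Dr1P; exists 1, 0; rewrite oner_neq0 scale1r.
    by rewrite GC //; exists (mxsub p p x) => //; exists x.
  (* When [x] anticommutes with [g], so does [z], and the two signs cancel in [z *m x]; multiplying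
     by A_0, the conjugate of [z], then recovers [x] since [z *m z = 1]. *)
  have Czx : C (z *m x).
    split; first exact: mE.
    by rewrite mulmxA gz mulNmx -(mulmxA z g x) ncx mulmxN opprK mulmxA.
  exists (Abar n 1 0), (kronI n 1 (mxsub p p (z *m x))); split.
  - by apply/Dr1P; exists 1, 1; rewrite oner_neq0 scale1r.
  - by exists (mxsub p p (z *m x)) => //; exists (z *m x).
  by rewrite -GC // mxconjM // Gz mulmxA -Gz -mxconjM // zz mxconj1 // mul1mx.
move=> [_ [_ [/Dr1P [a [e [a0 ->]]] [_ [y Cy ->] ->] xE]]].
have Eze : exists2 v, E v & mxconj G v = (Abar n 1 0 : 'M_n) ^+ e.
  elim: e {xE} => [|e [v Ev vE]]; first by exists 1%:M; [apply/sE/oner_neq0 | rewrite mxconj1].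
  exists (z *m v); first exact: mE.
  by rewrite mxconjM // Gz vE exprS.
have [v Ev vE] := Eze; suff -> : x = a%:M *m v *m y.
  by case: Cy => Ey _; exact: mE (mE _ _ (sE _ a0) Ev) Ey.
apply: (can_inj (mxconjK uG)).
by rewrite xE !mxconjM // mxconj1 // vE GC // mul_scalar_mx.
Qed.

Lemma toral_split (hK : (2%:R : K) != 0) n (E : 'M[K]_n -> Prop) :
  (0 < n)%N -> elem_ab2 E -> toral E -> ~ pgl_connected (pgl_centralizer E) ->
  exists k (H : 'M[K]_k -> Prop), [/\ n = (2 ^ 1 * k)%N, elem_ab2 H, toral H
    & pgl_conj E (prod_sub (Dr n 1) (tensI n 1 H))].
Proof.
move=> n0 abE [T [[_ _ _ [u uu dT]] _] ET] disc.
have uV : invmx u \in unitmx by rewrite unitmx_inv.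
have [[g [x [Cg Ex gx]]] | no] :=
    pselect (exists g x, [/\ pgl_centralizer E g, E x & g *m x <> x *m g]); last first.
  case: disc; apply: centralizer_connected => g x Cg Ex.
  by apply: contrapT => gx; apply: no; exists g, x.
(* Transport [E], [g] and [x] by the matrix [u] that diagonalizes a maximal torus containing [E]. *)
have [||| |k [H [hn abH tH cH]]] := @diag_split hK n (fun y => E (mxconj (invmx u) y))
    (mxconj u g) (mxconj u x) n0 (elem_ab2_conj uV abE).
- by move=> y /ET /dT; rewrite -[_ *m invmx u]/(mxconj _ _) mxconjVK.
- case: Cg => ug cg; split; first by rewrite unitmx_conj.
  by move=> y /cg /(proj_eq_conj u); rewrite (mxconjM g _ uu) (mxconjM _ g uu) mxconjVK.
- by rewrite mxconjK.
- by rewrite -!mxconjM // (inj_eq (can_inj (mxconjK uu))); apply/eqP.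
exists k, H; split=> //; apply: pgl_conj_trans cH; exists u => // y.
by rewrite -[_ *m invmx u]/(mxconj _ _) mxconjK.
Qed.

(** Each splitting halves the size, so repeating it while the centralizer of the remaining factor is
    disconnected must stop. *)
Lemma toral_decomposition (hK : (2%:R : K) != 0) n (E : 'M[K]_n -> Prop) :
  (0 < n)%N -> elem_ab2 E -> toral E -> ~ pgl_connected (pgl_centralizer E) ->
  exists r k (H : 'M[K]_k -> Prop), [/\ n = (2 ^ r.+1 * k)%N, elem_ab2 H, toral H,
      pgl_connected (pgl_centralizer H)
    & pgl_conj E (prod_sub (Dr n r.+1) (tensI n r.+1 H))].
Proof.
elim/ltn_ind: n E => n IH E n0 abE tE disc.
have [k [H1 [hn abH tH EH]]] := toral_split hK n0 abE tE disc.
have [con|ncon] := pselect (pgl_connected (pgl_centralizer H1)); first by exists 0, k, H1.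
have k0 : (0 < k)%N by move: n0; rewrite hn muln_gt0 => /andP [].
have kn : (k < n)%N by rewrite hn expn1 mul2n -addnn -[X in (X < _)%N]addn0 ltn_add2l.
have [r [m [H [hk abH2 tH2 cH2 HH]]]] := IH k kn H1 k0 abH tH ncon.
exists r.+1, m, H; split=> //; first by rewrite hn hk mulnA -expnD.
exact: pgl_conj_trans EH (conj_prod_sub hn HH).
Qed.

End Splitting.

Theorem theorem4p9 (K : closedFieldType) (hK : (2%:R : K) != 0)
  (n s t : nat) (hs : (0 < s)%N) (ht : (0 < t)%N) (hodd : odd t)
  (hn : n = (2 ^ s * t)%N) (E : 'M[K]_n -> Prop) :
  elem_ab2 E -> toral E -> ~ pgl_connected (pgl_centralizer E) ->
  exists r k : nat,
    [/\ (1 <= r <= s)%N, n = (2 ^ r * k)%N &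
      exists H : 'M[K]_k -> Prop,
        ((forall x, H x <-> pgl_trivial x) \/
         [/\ elem_ab2 H, toral H & pgl_connected (pgl_centralizer H)])
        /\ pgl_conj E (prod_sub (Dr n r) (tensI n r H))].
Proof.
move=> abE tE disc.
have n0 : (0 < n)%N by rewrite hn muln_gt0 expn_gt0.
have [r [k [H [hnk abH tH cH EH]]]] := toral_decomposition hK n0 abE tE disc.
exists r.+1, k; split=> //; last by exists H; split=> //; right.
(* [2 ^ r.+1] divides [n = 2 ^ s * t] and is coprime to the odd [t], so it divides [2 ^ s], giving
   [r.+1 <= s]. *)
have co : coprime (2 ^ r.+1) t by rewrite coprimeXl // coprime2n.
by rewrite /= -(@dvdn_Pexp2l 2) // -(Gauss_dvdl _ co) -hn hnk dvdn_mulr.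
Qed.
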